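(* Let $p,q\in[1,\infty)\setminus\{2\}$ and let $\mathcal{G}$ and $\mathcal{H}$ be ample Weyl groupoids satisfying condition (W) with compact unit spaces $X$ and $Y$, respectively. Let $\varphi\colon F^p_\lambda(\mathcal{G})\to F^q_\lambda(\mathcal{H})$ be a unital contractive homomorphism, let $\rho\colon Y\to X$ be the continuous map satisfying $\varphi(f)=f\circ\rho$ for $f\in C(X)$, and let $\psi_0\colon[\![\mathcal{G}]\!]\to[\![\mathcal{H}]\!]$ be the group homomorphism induced by $\varphi$. Then, for $TU\in[\![\mathcal{G}]\!]_{\mathrm{loc}}$, the assignment $$\psi(TU):=(\alpha^{-1}\circ\psi_0\circ\alpha)(T)\cdot\rho^{-1}(U)$$ is a well-defined unital semigroup homomorphism $\psi\colon[\![\mathcal{G}]\!]_{\mathrm{loc}}\to[\![\mathcal{H}]\!]_{\mathrm{loc}}$. Moreover, the pair $(\psi,\rho)$ defines an actor $h\colon\mathcal{G}\curvearrowright\mathcal{H}$. In particular, $\psi_0$ is injective if $\rho$ is surjective.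
   Context: A topological groupoid $\mathcal{G}$ is a small category with all morphisms invertible, with a locally compact topology making multiplication and inversion continuous, and with Hausdorff unit space $\mathcal{G}^{(0)}$. Range and domain are $\mathsf{r}(\gamma)=\gamma\gamma^{-1}$, $\mathsf{d}(\gamma)=\gamma^{-1}\gamma$; $\mathcal{G}x=\mathsf{d}^{-1}(\{x\})$, $x\mathcal{G}=\mathsf{r}^{-1}(\{x\})$, $x\mathcal{G}x=x\mathcal{G}\cap\mathcal{G}x$. It is étale if $\mathsf{r},\mathsf{d}$ are local homeomorphisms, effective if the interior of $\{\gamma:\mathsf{r}(\gamma)=\mathsf{d}(\gamma)\}$ equals $\mathcal{G}^{(0)}$, and ample if it is étale with a basis of compact open sets. A Weyl groupoid is an effective Hausdorff étale groupoid. An ample groupoid with compact unit space $X$ satisfies condition (W) if $\mathcal{G}x\setminus x\mathcal{G}x\neq\emptyset$ for every $x\in X$. An open bisection is an open $S\subseteq\mathcal{G}$ on which $\mathsf{r}$ and $\mathsf{d}$ are injective; $\mathcal{B}(\mathcal{G})$ is the set of these, a unital inverse semigroup with $ST=\{\gamma\tau:\gamma\in S,\tau\in T,\mathsf{d}(\gamma)=\mathsf{r}(\tau)\}$, $S^*=S^{-1}$, unit $\mathcal{G}^{(0)}$. Put $\alpha_S=\mathsf{r}|_S\circ(\mathsf{d}|_S)^{-1}\colon\mathsf{d}(S)\to\mathsf{r}(S)$; for Hausdorff étale effective groupoids $S\mapsto\alpha_S$ is injective. $[\![\mathcal{G}]\!]=\{\alpha_S:S\in\mathcal{B}(\mathcal{G}),\mathsf{d}(S)=\mathsf{r}(S)=\mathcal{G}^{(0)}\}$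 is the topological full group. $[\![\mathcal{G}]\!]_{\mathrm{loc}}$ is the set of $S\in\mathcal{B}(\mathcal{G})$ of the form $S=TU$ with $\alpha_T\in[\![\mathcal{G}]\!]$ and $U\subseteq\mathcal{G}^{(0)}$ clopen. For Hausdorff étale $\mathcal{G}$ with compact unit space $X$, $F^p_\lambda(\mathcal{G})$ is the completion of the convolution algebra $C_c(\mathcal{G})$, $(f*g)(\gamma)=\sum_{\tau\in\mathsf{r}(\gamma)\mathcal{G}}f(\tau)g(\tau^{-1}\gamma)$, in the norm $\sup_{x\in X}\|\lambda_x(f)\|$, where $\lambda_x(f)\xi=f*\xi$ on $\ell^p(\mathcal{G}x)$. It is unital and contains $C(X)$ isometrically. For $p\ne2$, $C(X)$ is the set $A_{\mathrm h}+iA_{\mathrm h}$ with $A=F^p_\lambda(\mathcal{G})$ and $A_{\mathrm h}=\{a:\|e^{ita}\|\le1\ \forall t\in\mathbb{R}\}$, and unital contractive homomorphisms preserve hermitian elements, so $\varphi$ restricts to a $*$-homomorphism $C(X)\to C(Y)$, given by $\rho$. Induced group homomorphism: every invertible $u\in F^p_\lambda(\mathcal{G})$ with $\|u\|,\|u^{-1}\|\leq1$ satisfies $u^{-1}fu=f\circ\underline\alpha_u$ ($f\in C(X)$) for a unique $\underline\alpha_u\in[\![\mathcal{G}]\!]$, every element of $[\![\mathcal{G}]\!]$ is of this form, and $\underline\alpha_u=\mathrm{id}$ iff $u\in C(X,\mathbb{T})$; similarly for $\mathcal{H}$. The homomorphism induced by $\varphi$ is $\psi_0(\underline\alpha_u)=\underline\alpha_{\varphi(u)}$.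 An actor $h\colon\mathcal{G}\curvearrowright\mathcal{H}$ consists of a continuous map $\rho_h\colon\mathcal{H}\to\mathcal{G}^{(0)}$ and a continuous map $(\gamma,\eta)\mapsto\gamma\cdot_h\eta$ from $\{(\gamma,\eta)\in\mathcal{G}\times\mathcal{H}:\mathsf{d}(\gamma)=\rho_h(\eta)\}$ to $\mathcal{H}$ with $\rho_h(\gamma\cdot\eta)=\mathsf{r}(\gamma)$, $\gamma_1\cdot(\gamma_2\cdot\eta)=(\gamma_1\gamma_2)\cdot\eta$, $\rho_h(\eta)\cdot\eta=\eta$, $\rho_h(\eta_1\eta_2)=\rho_h(\eta_1)$, $\mathsf{d}(\gamma\cdot\eta)=\mathsf{d}(\eta)$, and $\gamma\cdot(\eta_1\eta_2)=(\gamma\cdot\eta_1)\eta_2$. That the pair $(\psi,\rho)$ defines an actor means that $\rho_h(\eta)=\rho(\mathsf{r}(\eta))$ and $\gamma\cdot_h\eta=\tau\eta$, where $S\in[\![\mathcal{G}]\!]_{\mathrm{loc}}$ is any element containing $\gamma$ and $\tau$ is the unique element of $\psi(S)$ with $\mathsf{d}(\tau)=\mathsf{r}(\eta)$, is a well-defined actor. *)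

(* Defs.v *)
From HB Require Import structures.
From mathcomp Require Import all_boot all_order all_algebra.
From mathcomp Require Import complex.
From mathcomp Require Import all_classical all_reals all_analysis.

Set Implicit Arguments.
Unset Strict Implicit.
Unset Printing Implicit Defensive.

Import Order.TTheory GRing.Theory Num.Theory.
Import numFieldNormedType.Exports.

Local Open Scope classical_set_scope.
Local Open Scope ring_scope.

(* Topological groupoids are presented with a separate space of objects [obj].
   [unit] is a topological embedding (it is continuous with continuous left
   inverse [dom]), so [obj] is the unit space and [range unit] is its copy inside
   the space of arrows. Products are in function order: [mul g t] is meaningful
   only when [dom g = ran t]; other values are irrelevant. *)
Record topGroupoid := TopGroupoid {
  arr :> topologicalType;
  obj : topologicalType;
  ran : arr -> obj;
  dom : arr -> obj;
  unit : obj -> arr;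
  mul : arr -> arr -> arr;
  inv : arr -> arr;
  ran_unit : forall x, ran (unit x) = x;
  dom_unit : forall x, dom (unit x) = x;
  ran_mul : forall g t, dom g = ran t -> ran (mul g t) = ran g;
  dom_mul : forall g t, dom g = ran t -> dom (mul g t) = dom t;
  mulA : forall g t s, dom g = ran t -> dom t = ran s ->
    mul g (mul t s) = mul (mul g t) s;
  unit_mul : forall g, mul (unit (ran g)) g = g;
  mul_unit : forall g, mul g (unit (dom g)) = g;
  ran_inv : forall g, ran (inv g) = dom g;
  dom_inv : forall g, dom (inv g) = ran g;
  mul_inv : forall g, mul g (inv g) = unit (ran g);
  inv_mul : forall g, mul (inv g) g = unit (dom g);
  ran_continuous : continuous ran;
  dom_continuous : continuous dom;
  unit_continuous : continuous unit;
  inv_continuous : continuous inv;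
  mul_continuous :
    {within [set u : arr * arr | dom u.1 = ran u.2],
      continuous (fun u : arr * arr => mul u.1 u.2)};
  arr_locally_compact : locally_compact [set: arr];
  obj_hausdorff : hausdorff_space obj
}.

Definition local_homeomorphism (S T : topologicalType) (f : S -> T) :=
  continuous f /\
  forall x, exists U, [/\ open U, U x, set_inj U f &
    forall V, open V -> V `<=` U -> open (f @` V)].

Section Groupoid.
Variable G : topGroupoid.
Implicit Types (S T : set G).

Definition units : set G := range (@unit G).

Definition etale := local_homeomorphism (@ran G) /\ local_homeomorphism (@dom G).

Definition effective := interior [set g : G | ran g = dom g] = units.

Definition ample := etale /\
  forall (O : set G) g, open O -> O g ->
    exists K, [/\ compact K, open K, K g & K `<=` O].

Definition weyl := [/\ effective, hausdorff_space G & etale].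

Definition condition_W := forall x : obj G,
  [set g : G | dom g = x] `\` [set g : G | dom g = x /\ ran g = x] !=set0.

Definition open_bisection S :=
  [/\ open S, set_inj S (@ran G) & set_inj S (@dom G)].

Definition mul_set S T : set G :=
  [set g | exists s t, [/\ S s, T t, dom s = ran t & g = mul s t]].

Definition full_bisection S :=
  [/\ open_bisection S, (@dom G) @` S = setT & (@ran G) @` S = setT].

(* alpha_S; only used when [dom] maps [S] bijectively onto the unit space *)
Definition alpha S (x : obj G) : obj G :=
  ran (xget (unit x) [set g : G | S g /\ dom g = x]).

Definition tfg : set (obj G -> obj G) := alpha @` full_bisection.

(* alpha^{-1}; only used on [tfg] *)
Definition alpha_inv (s : obj G -> obj G) : set G :=
  xget set0 [set S | full_bisection S /\ alpha S = s].

Definition tfg_loc : set (set G) :=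
  [set S | open_bisection S /\
    exists T (U : set (obj G)),
      [/\ full_bisection T, clopen U & S = mul_set T (@unit G @` U)]].

End Groupoid.
Arguments units : clear implicits.

(* Unital Banach algebras. The case [bone = 0] is allowed: it is the algebra of
   a groupoid with empty unit space. *)
Record banachAlgebra (K : numFieldType) := BanachAlgebra {
  bcar :> completeNormedModType K;
  bmul : bcar -> bcar -> bcar;
  bone : bcar;
  bmulA : associative bmul;
  bmul1 : left_id bone bmul;
  bmulr1 : right_id bone bmul;
  bmulDl : left_distributive bmul +%R;
  bmulDr : right_distributive bmul +%R;
  bscalerAl : forall (k : K) a b, k *: bmul a b = bmul (k *: a) b;
  bscalerAr : forall (k : K) a b, k *: bmul a b = bmul a (k *: b);
  bnormM : forall a b, `|bmul a b| <= `|a| * `|b|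
}.

Definition unital_contractive_hom (K : numFieldType) (A B : banachAlgebra K)
    (phi : A -> B) :=
  [/\ linear phi,
      {morph phi : a b / bmul a b >-> bmul a b},
      phi (bone A) = bone B &
      forall a, `|phi a| <= `|a|].

Section ReducedAlgebra.
Variables (R : realType) (p : R) (G : topGroupoid).
Implicit Types (f g xi : G -> R[i]).

Definition Cc : set (G -> R[i]) :=
  [set f | continuous (f : G -> (R[i])^o) /\
           compact (closure [set g | f g != 0])].

(* The sum is finite for [f] in [Cc] and [G] Hausdorff etale; [fsbigop] gives it
   the value 0 otherwise. *)
Definition conv f g : G -> R[i] := fun c =>
  \sum_(t \in [set t : G | ran t = ran c]) f t * g (mul (inv t) c).

(* l^p norm of a function on [G]; l^p(Gx) is the space of functions on [G] of
   finite norm supported in the fibre [Gx] *)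
Definition lp_norm xi : \bar R :=
  poweR (\esum_(c in [set: G]) (complex.Re `|xi c| `^ p)%:E) p^-1.

Definition lambda_norm (x : obj G) f : \bar R :=
  ereal_sup [set lp_norm (conv f xi) | xi in
    [set xi : G -> R[i] | (forall c, dom c <> x -> xi c = 0) /\
                          (lp_norm xi <= 1)%E]].

(* [maxe 0] only matters if the unit space is empty. *)
Definition reduced_norm f : \bar R :=
  maxe 0%E (ereal_sup (range (lambda_norm ^~ f))).

Definition ext_units (f : obj G -> R[i]) : G -> R[i] :=
  fun c => if c \in units G then f (dom c) else 0.

(* F^p_lambda(G): a Banach algebra with an isometric homomorphism from
   ([Cc], [reduced_norm]) with dense range, i.e. a completion of it. Such a
   completion is unique up to a unique isometric isomorphism, and statements
   below quantify over all of them. The values of [emb] outside [Cc] are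
   irrelevant. *)
Record reduced_algebra := ReducedAlgebra {
  Fp :> banachAlgebra R[i];
  emb : (G -> R[i]) -> Fp;
  emb_linear : forall (k : R[i]) f g, Cc f -> Cc g ->
    emb (fun c => k * f c + g c) = k *: emb f + emb g;
  emb_conv : forall f g, Cc f -> Cc g -> emb (conv f g) = bmul (emb f) (emb g);
  emb_one : emb (ext_units (fun=> 1)) = bone Fp;
  emb_norm : forall f, Cc f -> (complex.Re `|emb f|)%:E = reduced_norm f;
  emb_dense : dense (emb @` Cc)
}.

Definition embC (A : reduced_algebra) (f : obj G -> R[i]) : A :=
  emb A (ext_units f).

(* [u] is invertible with [u] and its inverse [v] contractive, and
   [underline alpha_u = s] *)
Definition induces (A : reduced_algebra) (u : A) (s : obj G -> obj G) : Prop :=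
  tfg s /\
  exists v : A,
    [/\ bmul u v = bone A, bmul v u = bone A, `|u| <= 1, `|v| <= 1 &
        forall f : obj G -> R[i], continuous (f : obj G -> (R[i])^o) ->
          bmul (bmul v (embC A f)) u = embC A (f \o s)].
End ReducedAlgebra.

(* [psi0] is the group homomorphism induced by [phi], that is,
   [psi0 (underline alpha_u) = underline alpha_(phi u)] *)
Definition induced_hom (R : realType) (p q : R) (G H : topGroupoid)
    (A : reduced_algebra p G) (B : reduced_algebra q H) (phi : A -> B)
    (psi0 : (obj G -> obj G) -> (obj H -> obj H)) :=
  [/\ set_fun (@tfg G) (@tfg H) psi0,
      forall s t, tfg s -> tfg t -> psi0 (s \o t) = psi0 s \o psi0 t &
      forall (u : A) s, induces u s -> induces (phi u) (psi0 s)].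

Section Actor.
Variables G H : topGroupoid.

Definition is_actor (rhoh : H -> obj G) (act : G -> H -> H) :=
  [/\ continuous rhoh,
      {within [set u : G * H | dom u.1 = rhoh u.2],
        continuous (fun u : G * H => act u.1 u.2)},
      forall g e, dom g = rhoh e -> rhoh (act g e) = ran g,
      forall g1 g2 e, dom g1 = ran g2 -> dom g2 = rhoh e ->
        act g1 (act g2 e) = act (mul g1 g2) e &
  [/\ forall e, act (unit (rhoh e)) e = e,
      forall e1 e2, dom e1 = ran e2 -> rhoh (mul e1 e2) = rhoh e1,
      forall g e, dom g = rhoh e -> dom (act g e) = dom e &
      forall g e1 e2, dom g = rhoh e1 -> dom e1 = ran e2 ->
        act g (mul e1 e2) = mul (act g e1) e2]].

(* the formulas [rho_h e = rho (ran e)] and [g . e = t e], with [t] the element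
   of [psi S] over [ran e] for any [S] in [tfg_loc] containing [g], are
   meaningful, do not depend on [S], and give an actor *)
Definition defines_actor (psi : set G -> set H) (rho : obj H -> obj G) :=
  exists act : G -> H -> H,
    is_actor (rho \o @ran H) act /\
    forall g e, dom g = rho (ran e) ->
      (exists S, tfg_loc S /\ S g) /\
      forall S, tfg_loc S -> S g ->
        exists t, unique (fun t' => psi S t' /\ dom t' = ran e) t /\
                  act g e = mul t e.

End Actor.

(* Main.v *)
(* Every full bisection [T] of [G] gives the element [1_T] of F^p(G), which is
   contractive with contractive inverse [1_(T^-1)] and induces [alpha T]. If [T1]
   and [T2] agree over a clopen set [U], then [1_T1] and [1_T2] agree after being
   cut by the idempotent [1_U], and so do their images under [phi] after being cut
   by [1_U \o rho]; hence [psi0 (alpha T1)] and [psi0 (alpha T2)] agree on the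
   preimage of [U], and by effectiveness of [H] so do the bisections they come
   from. This is the well-definedness of [psi]. Applying [phi] to
   [1_(T^-1) f 1_T = f \o alpha T] gives [rho \o psi0 (alpha T) = alpha T \o rho],
   from which the remaining properties of [psi] and of the actor follow. Condition
   (W) ensures that every arrow lies in a full bisection. *)
From mathcomp Require Import all_boot all_order all_algebra.
From mathcomp Require Import complex.
From mathcomp Require Import all_classical all_reals all_analysis.
Require Import Defs.

Set Implicit Arguments.
Unset Strict Implicit.
Unset Printing Implicit Defensive.

Import Order.TTheory GRing.Theory Num.Theory.
Import numFieldNormedType.Exports.

Local Open Scope classical_set_scope.
Local Open Scope ring_scope.

(** * Cancellation rules and continuity of multiplication in a topological groupoid *)

Section GroupoidAlgebra.
Variable G : topGroupoid.
Implicit Types g t : G.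

Lemma mul_invKl g t : dom g = ran t -> mul (inv g) (mul g t) = t.
Proof. by move=> gt; rewrite mulA ?dom_inv// inv_mul gt unit_mul. Qed.

Lemma mul_invKr g t : ran g = ran t -> mul g (mul (inv g) t) = t.
Proof. by move=> gt; rewrite mulA ?ran_inv ?dom_inv// mul_inv gt unit_mul. Qed.

Lemma mulK g t : dom g = ran t -> mul (mul g t) (inv t) = g.
Proof. by move=> gt; rewrite -mulA ?ran_inv// mul_inv -gt mul_unit. Qed.

Lemma mulVK g t : dom g = dom t -> mul (mul g (inv t)) t = g.
Proof. by move=> gt; rewrite -mulA ?ran_inv ?dom_inv// inv_mul -gt mul_unit. Qed.

Lemma inv_unique g t : dom g = ran t -> mul g t = unit (ran g) -> t = inv g.
Proof.
by move=> gt e; rewrite -(mul_invKl gt) e -(dom_inv g) mul_unit.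
Qed.

Lemma invK g : inv (inv g) = g.
Proof.
by rewrite -(@inv_unique (inv g) g) ?dom_inv// inv_mul ran_inv.
Qed.

Lemma inv_unit (x : obj G) : inv (unit x) = unit x.
Proof.
rewrite -(@inv_unique (unit x) (unit x)) ?dom_unit ?ran_unit//.
by rewrite -{2}(dom_unit x) mul_unit.
Qed.

Lemma units_dom g : units G g -> unit (dom g) = g.
Proof. by move=> [x _ <-]; rewrite dom_unit. Qed.

Lemma units_ran g : units G g -> ran g = dom g.
Proof. by move=> [x _ <-]; rewrite dom_unit ran_unit. Qed.

(** [mul] is continuous only on composable pairs, so the pair of limits has to be approached within
    that set; composability near [F] ensures this. *)
Lemma mul_cvg (T : Type) (F : set_system T) {FF : Filter F} (f h : T -> G) g t :
  dom g = ran t -> (\forall i \near F, dom (f i) = ran (h i)) ->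
  f @ F --> g -> h @ F --> t -> (fun i => mul (f i) (h i)) @ F --> mul g t.
Proof.
move=> gt fh Fg Ft.
have /subspace_continuousP/(_ (g, t) gt) M := @mul_continuous G.
have P : (fun i => (f i, h i)) @ F --> within [set u : G * G | dom u.1 = ran u.2]
    (nbhs (g, t)).
  move=> A; rewrite /within/= => gtA.
  have : (fun i => (f i, h i)) @ F --> (g, t) by exact: cvg_pair.
  move=> /(_ _ gtA); rewrite !nbhs_simpl/= => FA.
  by apply: filterS2 fh FA => i c; apply.
exact: (cvg_comp _ _ P M).
Qed.

End GroupoidAlgebra.

(** * Full bisections, their sections over the unit space, and restrictions to clopen sets *)

Section Bisections.
Variable G : topGroupoid.
Hypotheses (G_etale : etale G) (G_effective : effective G).
Hypothesis G_hausdorff : hausdorff_space G.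
Implicit Types (g t : G) (S T : set G) (x : obj G) (U : set (obj G)).

(** The inverse of [dom] on a full bisection. Unlike [alpha T] it remembers the arrows. The default
    [unit x] is that of [alpha], which makes [alphaE] hold by unfolding. *)
Definition sec T x : G := xget (unit x) [set g | T g /\ dom g = x].

Definition inv_set T : set G := @inv G @^-1` T.

Lemma alphaE T x : alpha T x = ran (sec T x).
Proof. by []. Qed.

Lemma local_homeomorphism_open (X Y : topologicalType) (f : X -> Y) (V : set X) :
  local_homeomorphism f -> open V -> open (f @` V).
Proof.
move=> [fc fo] oV; rewrite openE => _ [x Vx <-].
have [U [oU Ux _ UV]] := fo x.
have oVU : open (f @` (V `&` U)) by apply: UV; [exact: openI|exact: subIsetr].
apply: (filterS _ (open_nbhs_nbhs (conj oVU _))).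
  by move=> _ [z [Vz _] <-]; exists z.
by exists x.
Qed.

Lemma units_open : open (units G).
Proof. by rewrite -G_effective; exact: open_interior. Qed.

Lemma full_sec T x : full_bisection T -> T (sec T x) /\ dom (sec T x) = x.
Proof.
move=> [_ Td _]; have [g Tg gx] : (@dom G @` T) x by rewrite Td.
by apply: (@xgetPex _ (unit x) [set g | T g /\ dom g = x]); exists g.
Qed.

Lemma full_mem T x : full_bisection T -> T (sec T x).
Proof. by move=> /(full_sec x)[]. Qed.

Lemma dom_sec T x : full_bisection T -> dom (sec T x) = x.
Proof. by move=> /(full_sec x)[]. Qed.

Lemma full_dom_inj T g t : full_bisection T -> T g -> T t -> dom g = dom t -> g = t.
Proof. by move=> [[_ _ i] _ _] Tg Tt; apply: i; rewrite inE. Qed.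

Lemma full_ran_inj T g t : full_bisection T -> T g -> T t -> ran g = ran t -> g = t.
Proof. by move=> [[_ i _] _ _] Tg Tt; apply: i; rewrite inE. Qed.

Lemma sec_dom T g : full_bisection T -> T g -> sec T (dom g) = g.
Proof. by move=> fT Tg; apply: (full_dom_inj fT) => //; [exact: full_mem|rewrite dom_sec]. Qed.

Lemma sec_unique T x g : full_bisection T -> T g -> dom g = x -> sec T x = g.
Proof. by move=> fT Tg <-; apply: sec_dom. Qed.

Lemma mem_sec T g : full_bisection T -> T g <-> sec T (dom g) = g.
Proof. by move=> fT; split=> [|<-]; [exact: sec_dom|exact: full_mem]. Qed.

Lemma full_eq S T : full_bisection S -> full_bisection T ->
  (forall x, sec S x = sec T x) -> S = T.
Proof.
by move=> fS fT ST; apply/seteqP; split => g; rewrite (mem_sec g fS) (mem_sec g fT) ST.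
Qed.

Lemma dom_open (O : set G) : open O -> open (@dom G @` O).
Proof. exact: local_homeomorphism_open G_etale.2. Qed.

(** As [dom] is an open map, the arrows of [T] in an open set [V] have an open set of domains, over
    which the section stays in [V]. *)
Lemma sec_continuous T : full_bisection T -> continuous (sec T).
Proof.
move=> fT x W.
rewrite nbhsE => -[V [oV Vx] VW].
have oTV : open (@dom G @` (T `&` V)).
  by apply: dom_open; apply: openI => //; case: fT => -[].
apply: (filterS _ (open_nbhs_nbhs (conj oTV _))).
  by move=> y [g [Tg Vg] <-] /=; rewrite sec_dom//; exact: VW.
by exists (sec T x); [split => //; exact: full_mem|rewrite dom_sec].
Qed.

Lemma alpha_continuous T : full_bisection T -> continuous (alpha T).
Proof.
move=> fT x; apply: (@continuous_comp _ _ _ (sec T) (@ran G)).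
  exact: sec_continuous.
exact: ran_continuous.
Qed.

Lemma alpha_surj T y : full_bisection T -> exists x, alpha T x = y.
Proof.
move=> fT; have [_ _ Tr] := fT; have [g Tg gy] : (@ran G @` T) y by rewrite Tr.
by exists (dom g); rewrite alphaE sec_dom.
Qed.

Lemma full_ran T y : full_bisection T -> exists2 t, T t & ran t = y.
Proof. by move=> [_ _ Tr]; have [t] : (@ran G @` T) y; [rewrite Tr|exists t]. Qed.

Lemma full_units : full_bisection (units G).
Proof.
split; first split.
- exact: units_open.
- by move=> g t; rewrite !inE => ug ut; rewrite !units_ran// => e;
    rewrite -(units_dom ug) -(units_dom ut) e.
- by move=> g t; rewrite !inE => ug ut e; rewrite -(units_dom ug) -(units_dom ut) e.
- by apply/seteqP; split => // x _; exists (unit x); [exists x|rewrite dom_unit].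
- by apply/seteqP; split => // x _; exists (unit x); [exists x|rewrite ran_unit].
Qed.

Lemma sec_units x : sec (units G) x = unit x.
Proof. by apply: (sec_unique full_units); [exists x|rewrite dom_unit]. Qed.

Lemma alpha_units : alpha (units G) = id.
Proof. by apply/funext => x; rewrite alphaE sec_units ran_unit. Qed.

Lemma full_inv T : full_bisection T -> full_bisection (inv_set T).
Proof.
move=> [[oT ri di] Td Tr]; split; first split.
- by apply: open_comp => // g _; exact: inv_continuous.
- move=> g t; rewrite !inE => Tg Tt e.
  by rewrite -(invK g) -(invK t) (di (inv g) (inv t)) ?inE// !dom_inv.
- move=> g t; rewrite !inE => Tg Tt e.
  by rewrite -(invK g) -(invK t) (ri (inv g) (inv t)) ?inE// !ran_inv.
- apply/seteqP; split => // x _; have [g Tg gx] : (@ran G @` T) x by rewrite Tr.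
  by exists (inv g); [rewrite /inv_set/= invK|rewrite dom_inv].
- apply/seteqP; split => // x _; have [g Tg gx] : (@dom G @` T) x by rewrite Td.
  by exists (inv g); [rewrite /inv_set/= invK|rewrite ran_inv].
Qed.

Lemma full_mul S T : full_bisection S -> full_bisection T ->
  full_bisection (mul_set S T).
Proof.
move=> fS fT; split; first split.
(* Openness: the second factor of a product [g] is the arrow of [T] over [dom g]; removing it is
   continuous, and the product set is the preimage of the open set [S] under this map. *)
- have -> : mul_set S T = (fun g => mul g (inv (sec T (dom g)))) @^-1` S.
    apply/seteqP; split => [_ [s [t [Ss Tt st ->]]]|g /= Sg].
      by rewrite /= dom_mul// sec_dom// mulK.
    exists (mul g (inv (sec T (dom g)))), (sec T (dom g)).
    split => //; first exact: full_mem.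
      by rewrite dom_mul ?ran_inv ?dom_inv// dom_sec.
    by rewrite mulVK// dom_sec.
  apply: open_comp; last by case: fS => -[].
  move=> g _; apply: mul_cvg; last 2 first.
  + exact: cvg_id.
  + apply: (@continuous_comp _ _ _ (@sec T \o @dom G) (@inv G)).
      apply: continuous_comp; first exact: dom_continuous.
      exact: sec_continuous.
    exact: inv_continuous.
  + by rewrite ran_inv dom_sec.
  + by apply: nearW => h; rewrite ran_inv dom_sec.
- move=> g g'; rewrite !inE => -[s [t [Ss Tt st ->]]] [s' [t' [Ss' Tt' st' ->]]].
  rewrite !ran_mul// => e; have e1 := full_ran_inj fS Ss Ss' e.
  by rewrite (full_ran_inj fT Tt Tt') ?e1// -st -st' e1.
- move=> g g'; rewrite !inE => -[s [t [Ss Tt st ->]]] [s' [t' [Ss' Tt' st' ->]]].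
  rewrite !dom_mul// => e; have e1 := full_dom_inj fT Tt Tt' e.
  by rewrite (full_dom_inj fS Ss Ss') ?e1// st st' e1.
- apply/seteqP; split => // x _.
  have e : dom (sec S (ran (sec T x))) = ran (sec T x) by rewrite dom_sec.
  exists (mul (sec S (ran (sec T x))) (sec T x)); last by rewrite dom_mul ?dom_sec.
  by exists (sec S (ran (sec T x))), (sec T x); split => //; exact: full_mem.
- apply/seteqP; split => // z _.
  have [y yz] := alpha_surj z fS; have [x xy] := alpha_surj y fT.
  have e : dom (sec S y) = ran (sec T x) by rewrite dom_sec.
  exists (mul (sec S y) (sec T x)); last by rewrite ran_mul.
  by exists (sec S y), (sec T x); split => //; exact: full_mem.
Qed.

Lemma sec_mul S T x : full_bisection S -> full_bisection T ->
  sec (mul_set S T) x = mul (sec S (alpha T x)) (sec T x).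
Proof.
move=> fS fT; have e : dom (sec S (alpha T x)) = ran (sec T x) by rewrite dom_sec.
apply: (sec_unique (full_mul fS fT)); last by rewrite dom_mul// dom_sec.
by exists (sec S (alpha T x)), (sec T x); split => //; exact: full_mem.
Qed.

Lemma alpha_mul S T : full_bisection S -> full_bisection T ->
  alpha (mul_set S T) = alpha S \o alpha T.
Proof.
by move=> fS fT; apply/funext => x; rewrite alphaE sec_mul// ran_mul// dom_sec.
Qed.

Lemma mul_set_units T : mul_set T (units G) = T.
Proof.
apply/seteqP; split => [_ [s [_ [Ts [x _ <-] sx ->]]]|g Tg].
  by move: sx; rewrite ran_unit => <-; rewrite mul_unit.
by exists g, (unit (dom g)); split; rewrite ?mul_unit ?ran_unit//; exists (dom g).
Qed.

Lemma units_mul_set T : mul_set (units G) T = T.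
Proof.
apply/seteqP; split => [_ [_ [s [[x _ <-] Ts sx ->]]]|g Tg].
  by move: sx; rewrite dom_unit => ->; rewrite unit_mul.
by exists (unit (ran g)), g; split; rewrite ?unit_mul ?dom_unit//; exists (ran g).
Qed.

Lemma mul_set_inv T : full_bisection T -> mul_set T (inv_set T) = units G.
Proof.
move=> fT; apply/seteqP; split => [_ [s [t [Ts Tt st ->]]]|_ [x _ <-]].
  rewrite (full_dom_inj fT Ts Tt) ?dom_inv//.
  by rewrite inv_mul; exists (dom t).
have [y yx] := alpha_surj x fT.
exists (sec T y), (inv (sec T y)); split; rewrite ?ran_inv ?mul_inv -?alphaE ?yx//.
  exact: full_mem.
by rewrite /inv_set/= invK; exact: full_mem.
Qed.

Lemma inv_mul_set T : full_bisection T -> mul_set (inv_set T) T = units G.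
Proof.
move=> fT; rewrite -{2}(_ : inv_set (inv_set T) = T); last first.
  by apply/seteqP; split => g; rewrite /inv_set/= invK.
exact/mul_set_inv/full_inv.
Qed.

(** Replaces the product [TU] by a restriction of [T], the form in which elements of [tfg_loc] are
    handled below. *)
Lemma mul_set_unit T U : mul_set T (@unit G @` U) = T `&` @dom G @^-1` U.
Proof.
apply/seteqP; split => [_ [s [_ [Ts [x Ux <-] sx ->]]]|g [Tg Ug]].
  by move: sx Ux; rewrite ran_unit => <- Us; rewrite mul_unit.
by exists g, (unit (dom g)); split; rewrite ?mul_unit ?ran_unit//; exists (dom g).
Qed.

(** A restriction recovers [U] as its set of domains, but [T] only over [U]. This is the ambiguity
    that [psi] has to be independent of. *)
Lemma restr_eqP T1 T2 U1 U2 : full_bisection T1 -> full_bisection T2 ->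
  T1 `&` @dom G @^-1` U1 = T2 `&` @dom G @^-1` U2 <->
  U1 = U2 /\ forall x, U1 x -> sec T1 x = sec T2 x.
Proof.
move=> f1 f2; split => [e|[<- e]]; last first.
  apply/seteqP; split => g [Tg Ug]; split => //.
    by move: Tg; rewrite (mem_sec g f1) (mem_sec g f2) e.
  by move: Tg; rewrite (mem_sec g f1) (mem_sec g f2) e.
have H x : U1 x -> U2 x /\ sec T1 x = sec T2 x.
  move=> Ux; have : (T1 `&` @dom G @^-1` U1) (sec T1 x).
    by split => /=; [exact: full_mem|rewrite dom_sec].
  rewrite e /= dom_sec// => -[T2x ?]; split => //.
  by rewrite (sec_unique f2 T2x)// dom_sec.
split=> [|x /H[]//]; apply/seteqP; split => [x /H[]//|x Ux].
have : (T2 `&` @dom G @^-1` U2) (sec T2 x).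
  by split => /=; [exact: full_mem|rewrite dom_sec].
by rewrite -e /= dom_sec// => -[].
Qed.

(* [T^-1 S] is isotropic over [U], hence consists of units there. *)
Lemma sec_alpha S T U : full_bisection S -> full_bisection T -> open U ->
  (forall x, U x -> alpha S x = alpha T x) ->
  forall x, U x -> sec S x = sec T x.
Proof.
move=> fS fT oU ST x Ux.
have fTi := full_inv fT.
have xST : ran (sec T x) = ran (sec S x) by rewrite -!alphaE ST.
pose D := mul_set (inv_set T) S `&` @dom G @^-1` U.
have oD : open D.
  apply: openI; first by case: (full_mul fTi fS) => -[].
  by apply: open_comp => // g _; exact: dom_continuous.
have DU : D `<=` units G.
  rewrite -G_effective -open_subsetE// => _ [[t [s [Tt Ss ts ->]]]].
  rewrite /= dom_mul// => Us; rewrite ran_mul//.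
  have e : inv t = sec T (dom s).
    apply: (full_ran_inj fT) => //; first exact: full_mem.
    by rewrite ran_inv ts -alphaE -ST// alphaE sec_dom.
  by rewrite -(dom_sec (dom s) fT) -e dom_inv.
have : D (mul (inv (sec T x)) (sec S x)).
  split; last by rewrite /= dom_mul ?dom_inv// dom_sec.
  exists (inv (sec T x)), (sec S x); rewrite dom_inv; split => //.
    by rewrite /inv_set/= invK; exact: full_mem.
  exact: full_mem.
move=> /DU/units_dom; rewrite dom_mul ?dom_inv// dom_sec// => e.
rewrite -[LHS](mul_invKr xST) -e.
by rewrite -{2}(dom_sec x fT) mul_unit.
Qed.

Lemma alpha_inj S T : full_bisection S -> full_bisection T -> alpha S = alpha T ->
  S = T.
Proof.
move=> fS fT ST; apply: full_eq => // x.
by apply: (@sec_alpha _ _ setT) => //; [exact: openT|rewrite ST].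
Qed.

Lemma alpha_invP (s : obj G -> obj G) : tfg s ->
  full_bisection (alpha_inv s) /\ alpha (alpha_inv s) = s.
Proof.
move=> [T fT Ts].
by apply: (@xgetPex _ set0 [set S | full_bisection S /\ alpha S = s]); exists T.
Qed.

Lemma open_bisection_restr T U : full_bisection T -> open U ->
  open_bisection (T `&` @dom G @^-1` U).
Proof.
move=> [[oT ri di] _ _] oU; split.
- by apply: openI => //; apply: open_comp => // g _; exact: dom_continuous.
- by apply: sub_in2 ri => g; rewrite !inE => -[].
- by apply: sub_in2 di => g; rewrite !inE => -[].
Qed.

Lemma tfg_locP S : tfg_loc S <->
  exists T U, [/\ full_bisection T, clopen U & S = T `&` @dom G @^-1` U].
Proof.
split=> [[_ [T [U [fT cU ->]]]]|[T [U [fT cU ->]]]].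
  by exists T, U; rewrite mul_set_unit.
split; first by apply: open_bisection_restr => //; case: cU.
by exists T, U; rewrite mul_set_unit.
Qed.

Lemma mul_restr S T U V : full_bisection S -> full_bisection T ->
  mul_set (S `&` @dom G @^-1` U) (T `&` @dom G @^-1` V) =
  mul_set S T `&` @dom G @^-1` (alpha T @^-1` U `&` V).
Proof.
move=> fS fT; apply/seteqP; split => [_ [s [t [[Ss Us] [Tt Vt] st ->]]]|].
  split; first by exists s, t.
  by rewrite /= dom_mul// alphaE sec_dom// -st.
move=> _ [[s [t [Ss Tt st ->]]]]; rewrite /= dom_mul// alphaE sec_dom// -st => -[Us Vt].
by exists s, t.
Qed.

Lemma clopen_preimage (X Y : topologicalType) (f : X -> Y) (U : set Y) :
  continuous f -> clopen U -> clopen (f @^-1` U).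
Proof.
move=> fc [oU cU]; split; first by apply: open_comp => // x _; exact: fc.
by apply: closed_comp => // x _; exact: fc.
Qed.

(** Inversion exchanges [ran] and [dom], so the conditions on [dom] carry over to [ran]. *)
Lemma full_of_symmetric T : open T -> (forall g, T g -> T (inv g)) ->
  set_inj T (@dom G) -> @dom G @` T = setT -> full_bisection T.
Proof.
move=> oT Ti di Td; split => //; first split => //.
  move=> g t; rewrite !inE => Tg Tt e.
  by rewrite -(invK g) -(invK t) (di (inv g) (inv t)) ?inE ?dom_inv//; exact: Ti.
apply/seteqP; split => // x _; have [g Tg gx] : (@dom G @` T) x by rewrite Td.
by exists (inv g); [exact: Ti|rewrite ran_inv].
Qed.

(** * Consequences of ampleness: full bisections through given arrows, and clopen sets of units *)

Hypothesis G_ample : ample G.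

(* The bisection is [K `|` K^-1 `|` {units away from dom K and ran K}] for a
   small compact open bisection [K] containing [g]. *)
Lemma full_through_moved g : dom g <> ran g ->
  exists T, full_bisection T /\ T g.
Proof.
move=> gE.
have := @obj_hausdorff G; rewrite open_hausdorff => /(_ _ _ (introN eqP gE)).
move=> [[/= A B]]; rewrite !inE => -[Ag Bg] [oA oB AB].
have [[_ /(_ g)[U [oU Ug ri _]]] [_ /(_ g)[V [oV Vg di _]]]] := G_etale.
have oO : open ((U `&` V) `&` (@dom G @^-1` A `&` @ran G @^-1` B)).
  apply: openI; first exact: openI.
  by apply: openI; apply: open_comp => // t _;
    [exact: dom_continuous|exact: ran_continuous].
have [K [cK oK Kg KO]] := G_ample.2 _ g oO (conj (conj Ug Vg) (conj Ag Bg)).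
pose D := @dom G @` K `|` @ran G @` K.
(* Domains of [K] lie in [A] and ranges in [B], so [dom K] and [ran K] are disjoint. *)
have KAB s t : K s -> K t -> dom s <> ran t.
  move=> /KO[_ [/= As _]] /KO[_ [_ /= Bt]] e.
  by suff : (A `&` B) (dom s) by [rewrite AB]; split; rewrite // e.
have cD : closed D.
  have h (f : G -> obj G) : continuous f -> closed (f @` K).
    move=> fc; apply: compact_closed; first exact: obj_hausdorff.
    by apply: continuous_compact => //; exact: continuous_subspaceT.
  by apply: closedU; apply: h; [exact: dom_continuous|exact: ran_continuous].
have Ks s : K s -> K (inv s) -> False.
  by move=> s1 s2; apply: (KAB s (inv s)) => //; rewrite ran_inv.
pose T := (K `|` inv_set K) `|` (units G `&` @dom G @^-1` (~` D)).
exists T; split; last by left; left.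
apply: full_of_symmetric.
- apply: openU; first apply: openU => //.
    by apply: open_comp => // t _; exact: inv_continuous.
  apply: openI; first exact: units_open.
  apply: open_comp; first by move=> t _; exact: dom_continuous.
  exact: closed_openC.
- move=> t [[Kt|Kt]|[[x _ <-] Dx]].
  + by left; right; rewrite /inv_set/= invK.
  + by left; left.
  + by right; split; rewrite inv_unit//; exists x.
(* Over [dom K] the set [T] is [K], over [ran K] it is [K^-1], and elsewhere it consists of units;
   [dom] is injective on each piece. *)
- have TK t : T t -> (@dom G @` K) (dom t) -> K t.
    move=> [[//|Kt]|[_ tD]] Kd; last by case: tD; left.
    by case: Kd => s Ks' e; case: (KAB s (inv t)); rewrite ?ran_inv.
  have TKi t : T t -> (@ran G @` K) (dom t) -> K (inv t).
    move=> [[Kt|//]|[_ tD]] Kd; last by case: tD; right.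
    by case: Kd => s Ks' e; case: (KAB t s).
  have Tu t : T t -> ~ D (dom t) -> units G t.
    move=> [[Kt|Kt]|[]//] tD; case: tD; first by left; exists t.
    by right; exists (inv t); rewrite // ran_inv.
  move=> s t; rewrite !inE => Ts Tt e.
  have [[dK|rK]|nD] := pselect (D (dom s)).
  + have Kt := TK t Tt; rewrite -e in Kt.
    by apply: di; rewrite ?inE//; [case: (KO _ (TK s Ts dK)) => -[]|case: (KO _ (Kt dK)) => -[]].
  + have Kt := TKi t Tt; rewrite -e in Kt.
    rewrite -(invK s) -(invK t); congr inv.
    by apply: ri; rewrite ?ran_inv// ?inE; [case: (KO _ (TKi s Ts rK)) => -[]|case: (KO _ (Kt rK)) => -[]].
  + have nD' := nD; rewrite e in nD'.
    by rewrite -(units_dom (Tu s Ts nD)) -(units_dom (Tu t Tt nD')) e.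
- apply/seteqP; split => // x _.
  have [[[t Kt tx]|[t Kt tx]]|nD] := pselect (D x).
  + by exists t => //; left; left.
  + by exists (inv t); [left; right; rewrite /inv_set/= invK|rewrite dom_inv].
  + exists (unit x); rewrite ?dom_unit//; right.
    by split; [exists x|rewrite /= dom_unit].
Qed.

(** For isotropic [g], condition (W) supplies a non-isotropic [h] with the domain of [g]. Then
    [g = (g h^-1) h] with both factors non-isotropic, and full bisections through the factors
    multiply to one through [g]. *)
Lemma full_through g : condition_W G -> exists T, full_bisection T /\ T g.
Proof.
move=> /(_ (dom g))[h [/= hg hr]].
have [gE|] := pselect (dom g = ran g); last exact: full_through_moved.
have hE : dom h <> ran h by move=> e; apply: hr; rewrite -e.
have ghi : dom g = ran (inv h) by rewrite ran_inv.
have e : dom (mul g (inv h)) <> ran (mul g (inv h)).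
  by rewrite dom_mul// ran_mul// dom_inv -gE -hg => /esym.
have [S [fS Sg]] := full_through_moved e; have [T [fT Th]] := full_through_moved hE.
exists (mul_set S T); split; first exact: full_mul.
exists (mul g (inv h)), h; split => //; first by rewrite dom_mul// dom_inv.
by rewrite mulVK.
Qed.

(** Ampleness gives a compact open set of arrows around [unit x], closed as [G] is Hausdorff; its
    trace on the unit space is clopen. *)
Lemma clopen_basis x (U : set (obj G)) : open U -> U x ->
  exists V, [/\ clopen V, V x & V `<=` U].
Proof.
move=> oU Ux.
have oO : open (@dom G @^-1` U) by apply: open_comp => // g _; exact: dom_continuous.
have [|K [cK oK Kx KU]] := G_ample.2 _ (unit x) oO; first by rewrite /= dom_unit.
exists (@unit G @^-1` K); split => //.
  apply: clopen_preimage; first exact: unit_continuous.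
  by split => //; exact: compact_closed.
by move=> y /KU; rewrite /= dom_unit.
Qed.

(** Allows equality of points of the unit space to be tested on indicator functions of clopen
    sets. *)
Lemma clopen_separates x y : (forall V, clopen V -> V x -> V y) -> x = y.
Proof.
move=> xy; apply: obj_hausdorff => A B; rewrite nbhsE => -[A' [oA Ax] AA] By.
have [V [cV Vx VA]] := clopen_basis oA Ax.
by exists y; split; [apply: AA; apply: VA; exact: xy|exact: nbhs_singleton].
Qed.

End Bisections.

(** * Complex norms, indicator functions and one-term sums *)

Section ComplexNorm.
Variable R : realType.
Implicit Type z : R[i].

Lemma normc_Re z : (complex.Re `|z|)%:C%C = `|z|.
Proof. by rewrite RRe_real ?normr_real. Qed.

Lemma Re_norm0 : complex.Re `|0 : R[i]| = 0.
Proof. by rewrite normr0. Qed.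

Lemma Re_norm1 : complex.Re `|1 : R[i]| = 1.
Proof. by rewrite normr1. Qed.

Lemma Re_norm_eq0 z : complex.Re `|z| = 0 -> z = 0.
Proof. by move=> e; apply/normr0_eq0; rewrite -normc_Re e. Qed.

Lemma indic_eq (X : Type) (U : set X) x y :
  \1_U x = \1_U y :> R[i] -> U x -> U y.
Proof.
rewrite !indicE => e Ux; apply: contrapT => Uy; move: e.
by rewrite (mem_set Ux) (memNset Uy) => /eqP; rewrite oner_eq0.
Qed.

Lemma continuous_indic (X : topologicalType) (U : set X) : clopen U ->
  continuous (\1_U : X -> (R[i])^o).
Proof.
move=> [oU cU] x.
have [Ux|Ux] := pselect (U x); apply: cvg_near_cst.
  apply: filterS (open_nbhs_nbhs (conj oU Ux)) => y Uy.
  by rewrite !indicE !mem_set.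
apply: filterS (open_nbhs_nbhs (conj (closed_openC cU) Ux)) => y Uy.
by rewrite !indicE !memNset.
Qed.

End ComplexNorm.

Lemma fsbig_single (R : Type) (idx : R) (op : Monoid.com_law idx)
    (T : choiceType) (D : set T) (F : T -> R) (d : T) :
  D d -> (forall t, D t -> t <> d -> F t = idx) ->
  \big[op/idx]_(t \in D) F t = F d.
Proof.
move=> Dd DF; rewrite -(@fsbig_widen _ _ _ _ [set d]) ?fsbig_set1//.
  by move=> t ->.
by move=> t [Dt td]; exact: DF.
Qed.

(** * Convolution with functions supported on a full bisection *)

Section ConvolutionAlgebra.
Variables (R : realType) (p : R) (G : topGroupoid).
Hypothesis p_ge1 : 1 <= p.
Hypotheses (G_etale : etale G) (G_effective : effective G).
Hypothesis G_hausdorff : hausdorff_space G.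
Hypothesis G_compact : compact [set: obj G].
Implicit Types (S T : set G) (a b : obj G -> R[i]) (xi : G -> R[i]).

(** For full [T], the convolution of [1_T] with the function [a] on the units. The family contains
    [1_T] (constant weight 1) and, by unfolding, [ext_units a] ([T] the units), and [conv_wind]
    shows that it is closed under convolution. *)
Definition wind a T : G -> R[i] := fun c => if c \in T then a (dom c) else 0.

Lemma wind_in a T c : T c -> wind a T c = a (dom c).
Proof. by move=> Tc; rewrite /wind mem_set. Qed.

Lemma wind_notin a T c : ~ T c -> wind a T c = 0.
Proof. by move=> Tc; rewrite /wind memNset. Qed.

Lemma full_compact T : full_bisection T -> compact T.
Proof.
move=> fT; have -> : T = sec T @` setT.
  apply/seteqP; split => [g Tg|_ [x _ <-]]; last exact: full_mem.
  by exists (dom g) => //; exact: sec_dom.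
by apply: continuous_compact => //; apply/continuous_subspaceT/sec_continuous.
Qed.

(** [T] is open, and closed because it is compact in a Hausdorff space. So extension by zero is
    continuous, with support in the compact set [T]. *)
Lemma Cc_wind a T : continuous (a : obj G -> (R[i])^o) -> full_bisection T ->
  Cc (wind a T).
Proof.
move=> ca fT; have cT : closed T by apply: compact_closed => //; exact: full_compact.
have oT : open T by case: fT => -[].
split=> [g|].
  have [Tg|Tg] := pselect (T g).
    apply: (@cvg_trans _ ((a \o @dom G) @ nbhs g)); last first.
      rewrite wind_in//; apply: (@continuous_comp _ _ (R[i])^o (@dom G) a).
        exact: dom_continuous.
      exact: ca.
    apply: near_eq_cvg.
    by apply: filterS (open_nbhs_nbhs (conj oT Tg)) => y Ty; rewrite wind_in.
  apply: cvg_near_cst.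
  by apply: filterS (open_nbhs_nbhs (conj (closed_openC cT) Tg)) => y Ty;
    rewrite !wind_notin.
apply: (subclosed_compact _ (full_compact fT)); first exact: closed_closure.
rewrite [X in _ `<=` X](closure_id T).1//; apply: closure_subset => g /=.
by apply: contraNP => Tg; rewrite wind_notin// eqxx.
Qed.

(** Left translation by [T^-1]: the value is [s^-1 c] for the arrow [s] of [T] with the range of
    [c], as [twistE] records. *)
Definition twist T c : G := mul (sec (inv_set T) (ran c)) c.

Lemma twistE S s c : full_bisection S -> S s -> ran s = ran c ->
  twist S c = mul (inv s) c.
Proof.
move=> fS Ss sc; rewrite /twist; congr mul.
by apply: (sec_unique (full_inv fS)); rewrite /inv_set/= ?invK ?dom_inv.
Qed.

(** Exactly one arrow with range [ran c] lies in [T], so the convolution sum has a single possibly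
    nonzero term. *)
Lemma conv_windl a T xi c : full_bisection T ->
  conv (wind a T) xi c = a (ran (twist T c)) * xi (twist T c).
Proof.
move=> fT; have [t Tt tc] := full_ran (ran c) fT.
rewrite /conv (@fsbig_single _ _ _ _ _ _ t)//.
  by rewrite wind_in// (twistE fT Tt tc) ran_mul ?dom_inv// ran_inv.
move=> u /= uc ut; rewrite wind_notin ?mul0r// => Tu.
by apply: ut; apply: (full_ran_inj fT) => //; rewrite tc.
Qed.

Lemma conv_wind a b S T : full_bisection S -> full_bisection T ->
  conv (wind a S) (wind b T) =
  wind (fun x => a (alpha T x) * b x) (mul_set S T).
Proof.
move=> fS fT; apply/funext => c; rewrite conv_windl//.
have [s Ss sc] := full_ran (ran c) fS.
rewrite (twistE fS Ss sc).
have [ST|ST] := pselect (mul_set S T c).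
  rewrite [RHS]wind_in//.
  case: ST => s' [t [Ss' Tt s't e]]; rewrite {}e in sc *.
  have -> : s = s' by apply: (full_ran_inj fS) => //; rewrite sc ran_mul.
  by rewrite mul_invKl// wind_in// dom_mul// alphaE sec_dom.
rewrite (wind_notin _ ST) wind_notin ?mulr0// => Tc; apply: ST.
exists s, (mul (inv s) c); split => //; first by rewrite ran_mul ?dom_inv// ran_inv.
by rewrite mul_invKr.
Qed.

Lemma twist_bij T : full_bisection T -> set_bij setT setT (twist T).
Proof.
move=> fT; have fTi := full_inv fT.
have K (S S' : set G) c : full_bisection S -> full_bisection S' ->
    (forall s, S s -> S' (inv s)) -> twist S' (twist S c) = c.
  move=> fS fS' SS'; have [s Ss sc] := full_ran (ran c) fS.
  rewrite (twistE fS Ss sc) (twistE fS' (SS' _ Ss)).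
    by rewrite invK mul_invKr.
  by rewrite ran_mul ?dom_inv.
split => //.
- move=> c c' _ _ e; rewrite -(K T (inv_set T) c)// ?e ?K//.
    by move=> s; rewrite /inv_set/= invK.
  by move=> s; rewrite /inv_set/= invK.
- move=> c _; exists (twist (inv_set T) c) => //.
  by apply: K.
Qed.

(** Convolution by [1_T] is composition with the bijection [twist T], a permutation of coordinates,
    so it preserves the [l^p] norm. *)
Lemma reduced_norm_wind1 T : full_bisection T ->
  (reduced_norm p (wind (fun=> 1%R) T) <= 1)%E.
Proof.
move=> fT; rewrite /reduced_norm ge_max lee01/=.
apply: ge_ereal_sup => _ [x _ <-]; apply: ge_ereal_sup => _ [xi [_ xi1] <-].
apply: le_trans xi1; rewrite /lp_norm [X in (_ <= poweR X _)%E](reindex_esum _ _ _ _ (twist_bij fT)).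
rewrite le_eqVlt; apply/orP; left; apply/eqP; congr poweR.
by apply: eq_esum => c _; rewrite conv_windl// mul1r.
Qed.

(** The test vector is the unit mass at [unit x], of norm at most 1 in [l^p(Gx)]. Convolution
    multiplies it by [a x], so a vanishing norm forces [a x = 0]. *)
Lemma reduced_norm_wind_eq0 a : (reduced_norm p (wind a (units G)) <= 0)%E ->
  forall x, a x = 0.
Proof.
move=> a0 x; have p0 : p != 0 by rewrite gt_eqF// (lt_le_trans ltr01).
have fU := full_units G_effective.
pose xi : G -> R[i] := \1_[set unit x].
have tU c : twist (units G) c = c.
  rewrite (@twistE _ (unit (ran c)))// ?ran_unit ?inv_unit ?unit_mul//.
  by exists (ran c).
have convE c : conv (wind a (units G)) xi c = a (ran c) * xi c.
  by rewrite conv_windl// tU.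
have xi_ge0 (f : G -> R[i]) c : (0 <= (complex.Re `|f c| `^ p)%:E)%E.
  by rewrite lee_fin powR_ge0.
have xi_norm : (lp_norm p xi <= 1)%E.
  rewrite /lp_norm (_ : esum _ _ = 1%E) ?poweR1r//.
  rewrite -(@esum_set1 _ _ (unit x) (fun=> 1%E)) ?lee01//.
  rewrite [RHS]esum_mkcond; apply: eq_esum => c _.
  rewrite /xi indicE; case: ifP => _; first by rewrite Re_norm1 powR1.
  by rewrite Re_norm0 powR0.
have : (lp_norm p (conv (wind a (units G)) xi) <= 0)%E.
  apply: le_trans a0; rewrite /reduced_norm le_max; apply/orP; right.
  apply: (@le_trans _ _ (lambda_norm p x (wind a (units G)))); last first.
    by apply: ereal_sup_ubound; exists x.
  apply: ereal_sup_ubound; exists xi => //; split => // c cx.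
  by rewrite /xi indicE memNset// => /= e; apply: cx; rewrite e dom_unit.
rewrite /lp_norm => n0.
have /poweR_eq0_eq0 s0 : poweR
    (\esum_(c in [set: G]) (complex.Re `|conv (wind a (units G)) xi c| `^ p)%:E) p^-1 = 0%E.
  by apply/eqP; rewrite eq_le n0 poweR_ge0.
have : ((complex.Re `|a x| `^ p)%:E <= 0)%E.
  rewrite -[X in (_ <= X)%E]s0; last by apply: esum_ge0 => c _; exact: xi_ge0.
  apply: esum_ge; exists [set unit x]; first by split => //; exact: finite_set1.
  rewrite fsbig_set1 convE ran_unit /xi indicE mem_set ?mulr1//.
rewrite lee_fin => a_le0; apply/Re_norm_eq0/(@powR_eq0_eq0 _ _ p)/eqP.
by rewrite eq_le a_le0 powR_ge0.
Qed.

End ConvolutionAlgebra.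

(** Serves to identify the unspecified inverse in [induces] with [1_(T^-1)] or with its image under
    [phi]. *)
Lemma binv_unique (K : numFieldType) (A : banachAlgebra K) (u v v' : A) :
  bmul u v = bone A -> bmul v' u = bone A -> v = v'.
Proof. by move=> uv vu; rewrite -[LHS]bmul1 -vu -bmulA uv bmulr1. Qed.

(** * Weighted bisections as elements of the reduced algebra *)

Section ReducedAlgebraTheory.
Variables (R : realType) (p : R) (G : topGroupoid) (A : reduced_algebra p G).
Hypothesis p_ge1 : 1 <= p.
Hypotheses (G_etale : etale G) (G_effective : effective G).
Hypothesis G_hausdorff : hausdorff_space G.
Hypothesis G_compact : compact [set: obj G].
Implicit Types (S T : set G) (a b f : obj G -> R[i]).

Definition emb_wind a T : A := emb A (wind a T).

Lemma embCE a : embC A a = emb_wind a (units G).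
Proof. by []. Qed.

Lemma emb_wind_mul a b S T :
  continuous (a : obj G -> (R[i])^o) -> continuous (b : obj G -> (R[i])^o) ->
  full_bisection S -> full_bisection T ->
  bmul (emb_wind a S) (emb_wind b T) =
  emb_wind (fun x => a (alpha T x) * b x) (mul_set S T).
Proof.
by move=> ca cb fS fT; rewrite -emb_conv; [rewrite conv_wind| exact: Cc_wind..].
Qed.

Lemma emb_wind_ext a b T : (forall x, a x = b x) -> emb_wind a T = emb_wind b T.
Proof. by move=> /funext ->. Qed.

Lemma continuous_one : continuous ((fun=> 1) : obj G -> (R[i])^o).
Proof. by move=> x; exact: cvg_cst. Qed.

Lemma continuous_alpha_comp f T : continuous (f : obj G -> (R[i])^o) ->
  full_bisection T -> continuous (f \o alpha T : obj G -> (R[i])^o).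
Proof.
move=> cf fT x; apply: (@continuous_comp _ _ (R[i])^o (alpha T) f).
  exact: alpha_continuous.
exact: cf.
Qed.

Lemma continuous_mul a b :
  continuous (a : obj G -> (R[i])^o) -> continuous (b : obj G -> (R[i])^o) ->
  continuous ((fun x => a x * b x) : obj G -> (R[i])^o).
Proof. by move=> ca cb x; apply: cvgM; [exact: ca|exact: cb]. Qed.

Lemma embC_mul a b :
  continuous (a : obj G -> (R[i])^o) -> continuous (b : obj G -> (R[i])^o) ->
  bmul (embC A a) (embC A b) = embC A (fun x => a x * b x).
Proof.
move=> ca cb; have fU := full_units G_effective.
rewrite !embCE (emb_wind_mul ca cb fU fU) mul_set_units; apply: emb_wind_ext => x.
by rewrite alpha_units.
Qed.

(** The difference of the two functions is embedded as 0, so its reduced norm is 0 and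
    [reduced_norm_wind_eq0] applies. *)
Lemma embC_inj a b :
  continuous (a : obj G -> (R[i])^o) -> continuous (b : obj G -> (R[i])^o) ->
  embC A a = embC A b -> forall x, a x = b x.
Proof.
move=> ca cb ab x; have fU := full_units G_effective.
have Ca := Cc_wind G_etale G_hausdorff G_compact ca fU.
have Cb := Cc_wind G_etale G_hausdorff G_compact cb fU.
(* The difference is written as [k * f + g] with [k = -1] to match [emb_linear]. *)
pose d y := - 1 * b y + a y.
have cd : continuous (d : obj G -> (R[i])^o).
  move=> y; apply: cvgD; last exact: ca.
  by apply: cvgM; [exact: cvg_cst|exact: cb].
have Cd := Cc_wind G_etale G_hausdorff G_compact cd fU.
have dE : wind d (units G) = (fun c => - 1 * wind b (units G) c + wind a (units G) c).
  by apply/funext => c; rewrite /wind; case: ifP; rewrite // mulr0 addr0.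
have e0 : emb A (wind d (units G)) = 0.
  rewrite dE emb_linear// -[emb A (wind a _)]/(embC A a) ab.
  by rewrite scaleN1r addNr.
have := emb_norm A Cd; rewrite e0 normr0 /= => /esym n0.
have : d x = 0.
  by apply: (reduced_norm_wind_eq0 p_ge1 G_effective); rewrite n0.
by rewrite /d mulN1r addrC => /eqP; rewrite subr_eq0 => /eqP.
Qed.

Lemma norm_emb_wind1 T : full_bisection T -> `|emb_wind (fun=> 1) T| <= 1.
Proof.
move=> fT; have C1 := Cc_wind G_etale G_hausdorff G_compact continuous_one fT.
have := reduced_norm_wind1 p fT; rewrite -(emb_norm A C1) lee_fin -lecR.
by rewrite RRe_real// normr_real.
Qed.

Lemma emb_wind1_inv T : full_bisection T ->
  bmul (emb_wind (fun=> 1) T) (emb_wind (fun=> 1) (inv_set T)) = bone A /\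
  bmul (emb_wind (fun=> 1) (inv_set T)) (emb_wind (fun=> 1) T) = bone A.
Proof.
move=> fT; have fTi := full_inv fT; have c1 := continuous_one.
rewrite (emb_wind_mul c1 c1 fT fTi) (emb_wind_mul c1 c1 fTi fT).
rewrite mul_set_inv// inv_mul_set// -emb_one.
by split; apply: emb_wind_ext => x; rewrite mulr1.
Qed.

Lemma induces_alpha T : full_bisection T ->
  induces (emb_wind (fun=> 1) T) (alpha T).
Proof.
move=> fT; have fTi := full_inv fT; have fU := full_units G_effective.
have c1 := continuous_one.
split; first by exists T.
have [uv vu] := emb_wind1_inv fT.
exists (emb_wind (fun=> 1) (inv_set T)); split; [exact: uv|exact: vu|exact: norm_emb_wind1|exact: norm_emb_wind1|].
move=> f cf; rewrite embCE (emb_wind_mul c1 cf fTi fU) mul_set_units.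
rewrite (@emb_wind_ext _ f) => [|x]; last by rewrite mul1r.
rewrite (emb_wind_mul cf c1 fTi fT) inv_mul_set//; apply: emb_wind_ext => x.
by rewrite mulr1.
Qed.

(** A cut by [1_U] on the right of [1_T] keeps the arrows with domain in [U]; a cut on the left of
    [1_(T^-1)] keeps the inverses of these. Both are stated because conjugation involves the element
    and its inverse. *)
Lemma emb_wind1_cut T1 T2 (U : set (obj G)) :
  full_bisection T1 -> full_bisection T2 -> clopen U ->
  (forall x, U x -> sec T1 x = sec T2 x) ->
  bmul (emb_wind (fun=> 1) T1) (embC A \1_U) =
    bmul (emb_wind (fun=> 1) T2) (embC A \1_U) /\
  bmul (embC A \1_U) (emb_wind (fun=> 1) (inv_set T1)) =
    bmul (embC A \1_U) (emb_wind (fun=> 1) (inv_set T2)).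
Proof.
move=> f1 f2 cU e; have fU := full_units G_effective.
have fi1 := full_inv f1; have fi2 := full_inv f2.
have cI := @continuous_indic R _ _ cU; have c1 := continuous_one.
have H g : U (dom g) -> T1 g <-> T2 g.
  by move=> Ug; rewrite (mem_sec g f1) (mem_sec g f2) e.
split.
  rewrite embCE (emb_wind_mul c1 cI f1 fU) (emb_wind_mul c1 cI f2 fU) !mul_set_units /emb_wind; congr emb.
  apply/funext => g; rewrite /wind mul1r !indicE.
  have [Ug|Ug] := pselect (U (dom g)); last by rewrite (memNset Ug); case: ifP; case: ifP.
  by congr (if _ then _ else _); apply/idP/idP; rewrite !inE => /H; apply.
rewrite embCE (emb_wind_mul cI c1 fU fi1) (emb_wind_mul cI c1 fU fi2) !units_mul_set /emb_wind; congr emb.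
(* For [g] in [T^-1], [alpha (inv_set T) (dom g)] is [ran g], so the weight of the left cut depends
   on [g] but not on [T]. *)
have W (T : set G) g : full_bisection T ->
    wind (fun x => \1_U (alpha (inv_set T) x) * 1) (inv_set T) g =
    if inv g \in T then \1_U (ran g) else 0 :> R[i].
  move=> fT; have [Tg|Tg] := pselect (T (inv g)).
    rewrite wind_in// mem_set// mulr1 alphaE sec_dom//.
    exact: full_inv.
  by rewrite wind_notin// memNset.
apply/funext => g; rewrite !W// indicE.
have [Ug|Ug] := pselect (U (ran g)); last by rewrite (memNset Ug); case: ifP; case: ifP.
rewrite -dom_inv in Ug.
by congr (if _ then _ else _); apply/idP/idP; rewrite !inE => /H; apply.
Qed.

End ReducedAlgebraTheory.

(** * Equivariance and locality of [psi0], extracted from [phi] *)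

Section InducedHomomorphism.
Variables (R : realType) (p q : R) (G H : topGroupoid).
Hypothesis q_ge1 : 1 <= q.
Hypotheses (G_ample : ample G) (G_weyl : weyl G).
Hypothesis G_compact : compact [set: obj G].
Hypotheses (H_ample : ample H) (H_weyl : weyl H).
Hypothesis H_compact : compact [set: obj H].
Variables (A : reduced_algebra p G) (B : reduced_algebra q H) (phi : A -> B).
Hypothesis phi_hom : unital_contractive_hom phi.
Variable rho : obj H -> obj G.
Hypothesis rho_continuous : continuous rho.
Hypothesis phi_rho : forall f : obj G -> R[i], continuous (f : obj G -> (R[i])^o) ->
  phi (embC A f) = embC B (f \o rho).
Variable psi0 : (obj G -> obj G) -> (obj H -> obj H).
Hypothesis psi0_induced : induced_hom phi psi0.

(** The inverse of [phi(1_T)] supplied by [induced_hom] is [phi(1_(T^-1))], by uniqueness of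
    inverses. The formula covers all continuous [f] on the units of [H], not only those factoring
    through [rho]. *)
Lemma psi0_conj (T : set G) (f : obj H -> R[i]) : full_bisection T ->
  continuous (f : obj H -> (R[i])^o) ->
  bmul (bmul (phi (emb_wind A (fun=> 1) (inv_set T))) (embC B f))
    (phi (emb_wind A (fun=> 1) T)) = embC B (f \o psi0 (alpha T)).
Proof.
move=> fT cf; have [G_eff G_haus G_et] := G_weyl.
have [_ phiM phi1 _] := phi_hom; have [_ _ indu] := psi0_induced.
have [uv vu] := emb_wind1_inv A G_et G_haus G_compact fT.
have [_ [w [uw _ _ _ <-]]] := indu _ _ (induces_alpha A G_et G_eff G_haus G_compact fT) => //.
by rewrite (binv_unique uw (v' := phi (emb_wind A (fun=> 1) (inv_set T))))// -phiM vu.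
Qed.

(** For clopen [U], the image of [1_(T^-1) 1_U 1_T] is computed in two ways: in [A] before applying
    [phi], and in [B] by [psi0_conj]. Comparison gives [\1_U \o alpha T \o rho = \1_U \o rho \o psi0
    (alpha T)], and clopen sets separate points. *)
Lemma rho_psi0 (T : set G) (y : obj H) : full_bisection T ->
  rho (psi0 (alpha T) y) = alpha T (rho y).
Proof.
move=> fT; have [G_eff G_haus G_et] := G_weyl; have [H_eff H_haus H_et] := H_weyl.
have [_ phiM _ _] := phi_hom; have [psi0T _ _] := psi0_induced.
apply/esym/(clopen_separates G_haus G_ample) => U cU.
have cI := @continuous_indic R _ _ cU.
have crI : continuous ((\1_U \o rho) : obj H -> (R[i])^o).
  move=> z; apply: (@continuous_comp _ _ (R[i])^o rho \1_U).
    exact: rho_continuous.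
  exact: cI.
have [S fS Se] : tfg (psi0 (alpha T)) by apply: psi0T; exists T.
have := psi0_conj fT crI.
rewrite -phi_rho// -!phiM.
have [_ [w [uw _ _ _ wI]]] := induces_alpha A G_et G_eff G_haus G_compact fT.
have [_ vu] := emb_wind1_inv A G_et G_haus G_compact fT.
rewrite -(binv_unique uw vu) wI// phi_rho; last exact: continuous_alpha_comp.
have cl : continuous ((\1_U \o alpha T) \o rho : obj H -> (R[i])^o).
  move=> z; apply: (@continuous_comp _ _ (R[i])^o rho (\1_U \o alpha T)).
    exact: rho_continuous.
  exact: continuous_alpha_comp.
have cr : continuous ((\1_U \o rho) \o psi0 (alpha T) : obj H -> (R[i])^o).
  by rewrite -Se; exact: continuous_alpha_comp.
move=> /(embC_inj q_ge1 H_et H_eff H_haus H_compact cl cr) /(_ y)/=.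
exact: indic_eq.
Qed.

(** For clopen [V], cutting [\1_V \o psi0 (alpha T)] on both sides by [\1_U \o rho] gives
    [phi(1_U 1_(T^-1)) 1_V phi(1_T 1_U)], which by [emb_wind1_cut] is the same for [T1] and [T2]. *)
Lemma psi0_agree (T1 T2 : set G) (U : set (obj G)) (y : obj H) :
  full_bisection T1 -> full_bisection T2 -> clopen U ->
  (forall x, U x -> sec T1 x = sec T2 x) -> U (rho y) ->
  psi0 (alpha T1) y = psi0 (alpha T2) y.
Proof.
move=> f1 f2 cU e Uy.
have [G_eff G_haus G_et] := G_weyl; have [H_eff H_haus H_et] := H_weyl.
have [_ phiM _ _] := phi_hom; have [psi0T _ _] := psi0_induced.
have cI := @continuous_indic R _ _ cU.
have crI : continuous ((\1_U \o rho) : obj H -> (R[i])^o).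
  move=> z; apply: (@continuous_comp _ _ (R[i])^o rho \1_U).
    exact: rho_continuous.
  exact: cI.
apply: (clopen_separates H_haus H_ample) => V cV.
have cJ := @continuous_indic R _ _ cV.
have cs T : full_bisection T -> continuous (\1_V \o psi0 (alpha T) : obj H -> (R[i])^o).
  move=> fT; have [S fS <-] : tfg (psi0 (alpha T)) by apply: psi0T; exists T.
  exact: continuous_alpha_comp.
have [e1 e2] := emb_wind1_cut A G_et G_eff G_haus G_compact f1 f2 cU e.
have cut T : full_bisection T ->
    bmul (bmul (embC B (\1_U \o rho)) (embC B (\1_V \o psi0 (alpha T))))
      (embC B (\1_U \o rho)) =
    bmul (bmul (phi (bmul (embC A \1_U) (emb_wind A (fun=> 1) (inv_set T))))
      (embC B \1_V)) (phi (bmul (emb_wind A (fun=> 1) T) (embC A \1_U))).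
  by move=> fT; rewrite !phiM phi_rho// -psi0_conj// !bmulA.
have : bmul (bmul (embC B (\1_U \o rho)) (embC B (\1_V \o psi0 (alpha T1))))
      (embC B (\1_U \o rho)) =
    bmul (bmul (embC B (\1_U \o rho)) (embC B (\1_V \o psi0 (alpha T2))))
      (embC B (\1_U \o rho)).
  by rewrite !cut// e1 e2.
have cm T : full_bisection T ->
    continuous ((fun z => (\1_U \o rho) z * (\1_V \o psi0 (alpha T)) z) : obj H -> (R[i])^o).
  by move=> fT; exact: (continuous_mul crI (cs _ fT)).
have M := embC_mul B H_et H_eff H_haus H_compact.
rewrite (M _ _ crI (cs _ f1)) (M _ _ crI (cs _ f2)) (M _ _ (cm _ f1) crI) (M _ _ (cm _ f2) crI).
move=> /(embC_inj q_ge1 H_et H_eff H_haus H_compact) E.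
have {E} := E (continuous_mul (cm _ f1) crI) (continuous_mul (cm _ f2) crI) y.
(* Since [U (rho y)] holds, the cutting factors are 1 at [y] and only values of [\1_V] remain. *)
by rewrite /= [\1_U _]indicE mem_set// !mul1r !mulr1; exact: indic_eq.
Qed.

End InducedHomomorphism.

(** * The semigroup homomorphism and the actor, built from groupoid data without the algebras *)

Section ActorOfHomomorphism.
Variables G H : topGroupoid.
Hypotheses (G_etale : etale G) (G_effective : effective G).
Hypotheses (G_ample : ample G) (G_W : condition_W G).
Hypothesis G_hausdorff : hausdorff_space G.
Hypotheses (H_etale : etale H) (H_effective : effective H).
Variable rho : obj H -> obj G.
Hypothesis rho_continuous : continuous rho.
Variable psi0 : (obj G -> obj G) -> (obj H -> obj H).
Hypothesis psi0_fun : set_fun (@tfg G) (@tfg H) psi0.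
Hypothesis psi0_comp : forall s t, tfg s -> tfg t -> psi0 (s \o t) = psi0 s \o psi0 t.
Hypothesis rho_equiv : forall (T : set G) y, full_bisection T ->
  rho (psi0 (alpha T) y) = alpha T (rho y).
Hypothesis psi0_local : forall (T1 T2 : set G) (U : set (obj G)) y,
  full_bisection T1 -> full_bisection T2 -> clopen U ->
  (forall x, U x -> sec T1 x = sec T2 x) -> U (rho y) ->
  psi0 (alpha T1) y = psi0 (alpha T2) y.
Implicit Types (S T : set G) (U : set (obj G)).

Definition lift T : set H := alpha_inv (psi0 (alpha T)).

Lemma lift_full T : full_bisection T -> full_bisection (lift T).
Proof. by move=> fT; apply: (alpha_invP _).1; apply: psi0_fun; exists T. Qed.

Lemma alpha_lift T : full_bisection T -> alpha (lift T) = psi0 (alpha T).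
Proof. by move=> fT; apply: (alpha_invP _).2; apply: psi0_fun; exists T. Qed.

Lemma lift_mul S T : full_bisection S -> full_bisection T ->
  lift (mul_set S T) = mul_set (lift S) (lift T).
Proof.
move=> fS fT; have fST := full_mul G_etale fS fT.
have [lS lT] := (lift_full fS, lift_full fT).
apply: (alpha_inj H_etale H_effective) => //.
- exact: lift_full.
- exact: full_mul.
- rewrite alpha_lift// !alpha_mul// !alpha_lift// psi0_comp//; first by exists S.
  by exists T.
Qed.

(* [psi0 id] is an idempotent and is surjective. *)
Lemma lift_units : lift (units G) = units H.
Proof.
have fU := full_units G_effective; have fl := lift_full fU.
apply: (alpha_inj H_etale H_effective) => //; first exact: full_units.
rewrite alpha_units//; apply/funext => y.
have [x <-] := alpha_surj y fl; rewrite /= alpha_lift//.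
rewrite -[LHS]/((psi0 (alpha (units G)) \o psi0 (alpha (units G))) x).
by rewrite -psi0_comp ?alpha_units//; exists (units G); rewrite ?alpha_units.
Qed.

(** Effectiveness of [H], through [sec_alpha], turns agreement of the maps over the open set
    [rho^-1(U)] into agreement of the arrows. *)
Lemma sec_lift T1 T2 U y : full_bisection T1 -> full_bisection T2 -> clopen U ->
  (forall x, U x -> sec T1 x = sec T2 x) -> U (rho y) ->
  sec (lift T1) y = sec (lift T2) y.
Proof.
move=> f1 f2 cU e Uy; have [l1 l2] := (lift_full f1, lift_full f2).
apply: (@sec_alpha _ H_etale H_effective _ _ (rho @^-1` U)) => //.
  by case: (clopen_preimage rho_continuous cU).
by move=> x Ux; rewrite !alpha_lift//; exact: (psi0_local f1 f2 cU).
Qed.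

(** The map [psi], defined through a chosen presentation [TU]; [loc_liftE] proves independence of
    the choice. Sets outside [tfg_loc] are sent to the empty set. *)
Definition loc_lift (S : set G) : set H := xget set0 [set K | exists T U,
  [/\ full_bisection T, clopen U, S = T `&` @dom G @^-1` U &
      K = lift T `&` @dom H @^-1` (rho @^-1` U)]].

(** By [restr_eqP] the chosen presentation has the same [U] and agrees with [T] over it, so by
    [sec_lift] the lifts agree over [rho^-1(U)]. *)
Lemma loc_liftE T U : full_bisection T -> clopen U ->
  loc_lift (T `&` @dom G @^-1` U) = lift T `&` @dom H @^-1` (rho @^-1` U).
Proof.
move=> fT cU; rewrite /loc_lift; set P := (X in xget _ X).
have /(@xgetPex _ set0) : exists K, P K by exists (lift T `&` @dom H @^-1` (rho @^-1` U)), T, U.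
move=> [T' [U' [fT' cU' /(restr_eqP _ _ fT fT')[UU' e] ->]]]; rewrite -UU'.
apply/restr_eqP; [exact: lift_full|exact: lift_full|split => // y Uy].
apply/esym/(sec_lift fT fT' cU) => // x.
Qed.

Lemma loc_lift_tfg_loc S : tfg_loc S -> tfg_loc (loc_lift S).
Proof.
move=> /tfg_locP[T [U [fT cU ->]]]; rewrite loc_liftE//; apply/tfg_locP.
exists (lift T), (rho @^-1` U); split => //; first exact: lift_full.
exact: clopen_preimage.
Qed.

Lemma loc_lift_units : loc_lift (units G) = units H.
Proof.
have fU := full_units G_effective.
rewrite -[units G]setIT -[setT](preimage_setT (@dom G)) loc_liftE//.
  by rewrite lift_units !preimage_setT setIT.
by split; [exact: openT|exact: closedT].
Qed.

Lemma loc_lift_mul S T : tfg_loc S -> tfg_loc T ->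
  tfg_loc (mul_set S T) /\ loc_lift (mul_set S T) = mul_set (loc_lift S) (loc_lift T).
Proof.
move=> /tfg_locP[S1 [U [fS cU ->]]] /tfg_locP[T1 [V [fT cV ->]]].
have fST := full_mul G_etale fS fT; have [lS lT] := (lift_full fS, lift_full fT).
have cW : clopen (alpha T1 @^-1` U `&` V).
  by apply: clopenI => //; apply: clopen_preimage => //; exact: alpha_continuous.
rewrite mul_restr//; split.
  by apply/tfg_locP; exists (mul_set S1 T1), (alpha T1 @^-1` U `&` V).
rewrite !loc_liftE// mul_restr// lift_mul//; congr (_ `&` _ @^-1` _).
(* The sets of domains on both sides coincide because [rho] intertwines [psi0 (alpha T1)] with
   [alpha T1]. *)
by apply/seteqP; split => y [] /=; rewrite alpha_lift// rho_equiv.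
Qed.

Definition through (g : G) : set G :=
  xget set0 [set T | full_bisection T /\ T g].

Lemma throughP g : full_bisection (through g) /\ through g g.
Proof.
apply: (@xgetPex _ set0 [set T | full_bisection T /\ T g]).
exact: full_through.
Qed.

(** One full bisection through [g] is picked; [lift_actE] shows that any other gives the same
    arrow. *)
Definition lift_act (g : G) (e : H) : H := mul (sec (lift (through g)) (ran e)) e.

(** Two full bisections through [g] share an open set of arrows around it, so their sections agree
    over a clopen neighbourhood of [dom g] and [sec_lift] applies. *)
Lemma lift_actE T g e : full_bisection T -> T g -> dom g = rho (ran e) ->
  lift_act g e = mul (sec (lift T) (ran e)) e.
Proof.
move=> fT Tg ge; have [fP Pg] := throughP g; congr mul.
have oD : open (@dom G @` (T `&` through g)).
  by apply: (dom_open G_etale); apply: openI; [case: fT => -[]|case: fP => -[]].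
have [|U [cU Ug UD]] := clopen_basis G_hausdorff G_ample oD (x := dom g).
  by exists g.
apply: (@sec_lift _ _ U) => //; last by rewrite -ge.
by move=> _ /UD[t [Tt Pt] <-]; rewrite !sec_dom.
Qed.

(** Pairs near [(g, e)] have their first arrow in [through g], which then serves for all of them:
    locally the action is translation by one fixed full bisection of [H]. *)
Lemma lift_act_continuous :
  {within [set u : G * H | dom u.1 = rho (ran u.2)],
    continuous (fun u : G * H => lift_act u.1 u.2)}.
Proof.
apply/subspace_continuousP => -[g e] /= ge.
have [fT Tg] := throughP g; have fL := lift_full fT.
have oT : open (through g) by case: fT => -[].
pose D := [set u : G * H | dom u.1 = rho (ran u.2)].
have near_act : {near within D (nbhs (g, e)),
    (fun u => mul (sec (lift (through g)) (ran u.2)) u.2) =1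
    (fun u => lift_act u.1 u.2)}.
  rewrite /prop_near1 /within/=.
  have : nbhs (g, e) (@fst G H @^-1` through g).
    by apply: cvg_fst; exact: open_nbhs_nbhs.
  by apply: filterS => -[g' e'] /= Tg' ge'; rewrite (lift_actE fT Tg' ge').
apply: cvg_trans (near_eq_cvg near_act) _.
apply: cvg_trans (cvg_app _ (@cvg_within _ _ _ _)) _.
apply: mul_cvg.
- by rewrite dom_sec.
- by apply: nearW => u; rewrite dom_sec.
- apply: (@continuous_comp _ _ _ (fun u : G * H => ran u.2) (sec (lift (through g)))).
    apply: (@continuous_comp _ _ _ (@snd G H) (@ran H)); first exact: cvg_snd.
    exact: ran_continuous.
  exact: sec_continuous.
- exact: cvg_snd.
Qed.

Lemma ran_lift_act g e : dom g = rho (ran e) ->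
  ran (lift_act g e) = psi0 (alpha (through g)) (ran e).
Proof.
move=> ge; have [fT Tg] := throughP g; have fL := lift_full fT.
by rewrite /lift_act ran_mul ?dom_sec// -alphaE alpha_lift.
Qed.

Lemma lift_act_actor : is_actor (rho \o @ran H) lift_act.
Proof.
split; [|exact: lift_act_continuous|..|split].
- move=> e; apply: (@continuous_comp _ _ _ (@ran H) rho).
    exact: ran_continuous.
  exact: rho_continuous.
- move=> g e /= ge; have [fT Tg] := throughP g.
  by rewrite /= ran_lift_act// rho_equiv// -ge alphaE sec_dom.
- move=> g1 g2 e g12 ge; have [f1 T1g] := throughP g1; have [f2 T2g] := throughP g2.
  have [l1 l2] := (lift_full f1, lift_full f2).
  (* The product of the two chosen bisections contains [mul g1 g2] and may replace the one chosen
     for it. *)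
  have g12T : mul_set (through g1) (through g2) (mul g1 g2) by exists g1, g2.
  rewrite (lift_actE (full_mul G_etale f1 f2) g12T) ?dom_mul//.
  rewrite lift_mul// sec_mul// {1}/lift_act ran_lift_act// -alpha_lift//.
  by rewrite -mulA ?dom_sec.
(* Unit arrows may be made to act through [units G], whose lift is [units H]. *)
- move=> e; rewrite (lift_actE (full_units G_effective)) ?dom_unit//.
    by rewrite lift_units sec_units// unit_mul.
  by exists (rho (ran e)).
- by move=> e1 e2 e12; rewrite /= ran_mul.
- move=> g e ge; have [fT Tg] := throughP g; have fL := lift_full fT.
  by rewrite /lift_act dom_mul// dom_sec.
- move=> g e1 e2 ge e12; have [fT Tg] := throughP g; have fL := lift_full fT.
  by rewrite /lift_act ran_mul// mulA// dom_sec.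
Qed.

Lemma loc_lift_defines_actor : defines_actor loc_lift rho.
Proof.
exists lift_act; split; first exact: lift_act_actor.
move=> g e ge; split.
  have [fT Tg] := throughP g; exists (through g); split => //.
  apply/tfg_locP; exists (through g), setT.
  by rewrite preimage_setT setIT; split => //; split; [exact: openT|exact: closedT].
move=> _ /tfg_locP[T [U [fT cU ->]]] [Tg Ug]; have fL := lift_full fT.
(* This arrow survives the restriction to [rho^-1(U)] because [rho (ran e) = dom g] lies in [U]. *)
exists (sec (lift T) (ran e)); split; last exact: lift_actE.
rewrite loc_liftE//; split => [|t [[Lt _] te]]; last exact: sec_unique.
split; last exact: dom_sec.
by split; [exact: full_mem|rewrite /= dom_sec// -ge].
Qed.

End ActorOfHomomorphism.

Theorem theorem6p10 (R : realType) (p q : R)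
    (p_ge1 : 1 <= p) (p_neq2 : p <> 2%:R) (q_ge1 : 1 <= q) (q_neq2 : q <> 2%:R)
    (G H : topGroupoid)
    (G_ample : ample G) (G_weyl : weyl G) (G_W : condition_W G)
    (G_compact : compact [set: obj G])
    (H_ample : ample H) (H_weyl : weyl H) (H_W : condition_W H)
    (H_compact : compact [set: obj H])
    (A : reduced_algebra p G) (B : reduced_algebra q H)
    (phi : A -> B) (phi_hom : unital_contractive_hom phi)
    (rho : obj H -> obj G) (rho_continuous : continuous rho)
    (phi_rho : forall f : obj G -> R[i], continuous (f : obj G -> (R[i])^o) ->
      phi (embC A f) = embC B (f \o rho))
    (psi0 : (obj G -> obj G) -> (obj H -> obj H))
    (psi0_induced : induced_hom phi psi0) :
  (exists psi : set G -> set H,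
    [/\ set_fun (@tfg_loc G) (@tfg_loc H) psi,
        forall (T : set G) (U : set (obj G)), full_bisection T -> clopen U ->
          psi (mul_set T (@unit G @` U)) =
          mul_set (alpha_inv (psi0 (alpha T))) (@unit H @` (rho @^-1` U)),
        psi (units G) = units H,
        forall S T, tfg_loc S -> tfg_loc T ->
          tfg_loc (mul_set S T) /\
          psi (mul_set S T) = mul_set (psi S) (psi T) &
        defines_actor psi rho]) /\
  (set_surj [set: obj H] [set: obj G] rho -> set_inj (@tfg G) psi0).
Proof.
have [G_eff G_haus G_et] := G_weyl; have [H_eff H_haus H_et] := H_weyl.
have [psi0_fun psi0_comp _] := psi0_induced.
have equiv (T : set G) y : full_bisection T ->
    rho (psi0 (alpha T) y) = alpha T (rho y).
  exact: (rho_psi0 q_ge1 G_ample G_weyl G_compact H_weyl H_compact phi_hom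
    rho_continuous phi_rho psi0_induced).
have agree (T1 T2 : set G) (U : set (obj G)) (y : obj H) :
    full_bisection T1 -> full_bisection T2 -> clopen U ->
    (forall x, U x -> sec T1 x = sec T2 x) -> U (rho y) ->
    psi0 (alpha T1) y = psi0 (alpha T2) y.
  exact: (psi0_agree q_ge1 G_weyl G_compact H_ample H_weyl H_compact phi_hom
    rho_continuous phi_rho psi0_induced).
split.
  exists (loc_lift rho psi0); split.
  - by move=> S; exact: loc_lift_tfg_loc.
  - by move=> T U fT cU; rewrite !mul_set_unit loc_liftE.
  - exact: loc_lift_units.
  - by move=> S T; exact: loc_lift_mul.
  - exact: loc_lift_defines_actor.
(* Equivariance reads [alpha S (rho y) = rho (psi0 (alpha S) y)], so [psi0 (alpha S)] determines
   [alpha S] on the range of [rho]. *)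
move=> rho_surj _ _ /set_mem[S fS <-] /set_mem[T fT <-] ST.
apply/funext => x; have [y _ <-] := rho_surj x I.
by rewrite -!equiv// ST.
Qed.
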